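(* Assume $x(0)=x'(0)=0$. Let $L_3(t,s)=(\omega^3-\omega)\sin(\omega(t-s))+2\omega^2\cos(\omega(t-s))$. Then $x(t)\to0$ as $t\to\infty$ if and only if $y_2(t)\to0$ as $t\to\infty$ and \[ \lim_{t\to\infty}\int_0^tE(t,s)L_3(t,s)y_2(s)\,ds=0. \]
   Context: Standing assumptions: $\omega>0$ is a constant; $p\in C^1([0,\infty))$ with $p(t)>0$ and $p'(t)<0$ for all $t\ge0$, $\int_0^\infty p(t)\,dt=\infty$ and $\int_0^\infty p(t)^2\,dt<\infty$; $f\in L^1_{\mathrm{loc}}([0,\infty))$. $x$ denotes the solution of $x''(t)+p(t)x'(t)+\omega^2x(t)=f(t)$, $t\ge0$. Notation: $E(t,s)=\exp(-\frac12\int_s^tp(\tau)\,d\tau)$ for $0\le s\le t$; $y_1(t)=\int_0^te^{-\omega^2(t-s)}f(s)\,ds$; $y_2(t)=\int_0^te^{-\omega^2(t-s)}y_1(s)\,ds=\int_0^t(t-s)e^{-\omega^2(t-s)}f(s)\,ds$. *)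

(* Defs.v *)
From HB Require Import structures.
From mathcomp Require Import all_boot all_order all_algebra.
From mathcomp Require Import all_classical all_reals all_analysis.
Set Implicit Arguments. Unset Strict Implicit. Unset Printing Implicit Defensive.
Import Order.TTheory GRing.Theory Num.Theory.
Import numFieldNormedType.Exports.
Local Open Scope classical_set_scope.
Local Open Scope ring_scope.

Section Defs.
Variable R : realType.
Notation mu := (@lebesgue_measure R).

Definition Icc_int (a b : R) (g : R -> R) : R := Rintegral mu `[a, b] g.

Definition Efun (p : R -> R) (t s : R) : R := expR (- (2^-1) * Icc_int s t p).

Definition y1 (w : R) (f : R -> R) (t : R) : R :=
  Icc_int 0 t (fun s => expR (- w ^+ 2 * (t - s)) * f s).

Definition y2 (w : R) (f : R -> R) (t : R) : R :=
  Icc_int 0 t (fun s => expR (- w ^+ 2 * (t - s)) * y1 w f s).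

Definition L3 (w : R) (t s : R) : R :=
  (w ^+ 3 - w) * sin (w * (t - s)) + 2 * w ^+ 2 * cos (w * (t - s)).

(* Standing assumptions on p: C^1 on [0,oo) (derivative p' on (0,oo) extending
   continuously to [0,oo)), p > 0, p' < 0, int p = oo, int p^2 < oo. *)
Definition damping_ok (p p' : R -> R) : Prop :=
  {within `[0%R, +oo[, continuous p} /\
  (forall t : R, 0 < t -> is_derive t 1 p (p' t)) /\
  {within `[0%R, +oo[, continuous p'} /\
  (forall t : R, 0 <= t -> 0 < p t) /\
  (forall t : R, 0 <= t -> p' t < 0) /\
  (\int[mu]_(t in `[0%R, +oo[) (p t)%:E = +oo)%E /\
  (\int[mu]_(t in `[0%R, +oo[) ((p t) ^+ 2)%:E < +oo)%E.

Definition L1loc (f : R -> R) : Prop :=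
  forall T : R, 0 <= T -> mu.-integrable `[0, T] (EFin \o f).

(* (Caratheodory) solution x of x'' + p x' + w^2 x = f on [0,oo), with
   derivative v = x': x is C^1 on [0,oo) and x' is absolutely continuous with
   x'(t) = x'(0) + int_0^t (f - p x' - w^2 x). *)
Definition is_solution (p : R -> R) (w : R) (f : R -> R) (x v : R -> R) : Prop :=
  {within `[0%R, +oo[, continuous x} /\
  (forall t : R, 0 < t -> is_derive t 1 x (v t)) /\
  {within `[0%R, +oo[, continuous v} /\
  (forall t : R, 0 <= t ->
     v t = v 0 + Icc_int 0 t (fun s => f s - p s * v s - w ^+ 2 * x s)).

End Defs.

(* Main.v *)
Require Import Defs.
From mathcomp Require Import all_boot all_order all_algebra.
From mathcomp Require Import all_classical all_reals all_analysis.
From mathcomp Require Import ring lra.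
Set Implicit Arguments. Unset Strict Implicit. Unset Printing Implicit Defensive.
Import Order.TTheory GRing.Theory Num.Theory.
Import numFieldNormedType.Exports.
Local Open Scope classical_set_scope.
Local Open Scope ring_scope.

(** With [a = w^2], [f = (d/dt + a)^2 y2], so [z = x - y2] solves
    [z'' + p z' + w^2 z = (2 a - p) y2' + (a^2 - a) y2], an equation in which
    [f] no longer appears and all data are continuous. With [q = p/2], the pair
    [(z' + q z, w z)] is a rotation at speed [w] damped by [exp (- int q)],
    driven by that right-hand side and by [(q' + q^2) z], and the integral [I] of
    [E L3 y2] is a component of another such pair. After the [y2'] term is
    absorbed into the unknown, the difference [z - I] is driven only by terms
    bounded by [(q + |q'|) |y2|] and [(|q'| + q^2) |z|]. As
    [int q = oo] while [|q'|] and [q^2] are integrable, [z - I -> 0] once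
    [y2 -> 0] and [z] is bounded. Finally [x -> 0] forces [y2 -> 0], because
    [(d/dt + a)^2 z = (2 a - p) x' + (a^2 - a) x], where [p x' = (p x)' - p' x]
    and [int |p' x|] over [[T, oo)] is small for large [T]. *)

(** * Derivative rules in a form suited to automation *)

Definition has_deriv (R : realType) (f : R -> R) (t a : R) : Prop :=
  is_derive t 1 f a.

Lemma has_deriv_eq (R : realType) (f : R -> R) (t a b : R) :
  has_deriv f t a -> a = b -> has_deriv f t b.
Proof. by move=> fa <-. Qed.

Lemma has_deriv_cst (R : realType) (c t : R) : has_deriv (fun=> c) t 0.
Proof. exact: is_derive_cst. Qed.

Lemma has_deriv_id (R : realType) (t : R) : has_deriv id t 1.
Proof. exact: is_derive_id. Qed.

Lemma has_derivD (R : realType) (f g : R -> R) (t a b : R) :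
  has_deriv f t a -> has_deriv g t b ->
  has_deriv (fun s => f s + g s) t (a + b).
Proof. exact: is_deriveD. Qed.

Lemma has_derivN (R : realType) (f : R -> R) (t a : R) :
  has_deriv f t a -> has_deriv (fun s => - f s) t (- a).
Proof. exact: is_deriveN. Qed.

Lemma has_derivM (R : realType) (f g : R -> R) (t a b : R) :
  has_deriv f t a -> has_deriv g t b ->
  has_deriv (fun s => f s * g s) t (f t * b + g t * a).
Proof. exact: is_deriveM. Qed.

Lemma has_deriv_expR (R : realType) (f : R -> R) (t a : R) :
  has_deriv f t a -> has_deriv (fun s => expR (f s)) t (expR (f t) * a).
Proof. by move=> fa; exact: (@is_derive1_comp _ expR f). Qed.

Lemma has_deriv_cos (R : realType) (f : R -> R) (t a : R) :
  has_deriv f t a -> has_deriv (fun s => cos (f s)) t (- sin (f t) * a).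
Proof. by move=> fa; exact: (@is_derive1_comp _ (@cos R) f). Qed.

Lemma has_deriv_sin (R : realType) (f : R -> R) (t a : R) :
  has_deriv f t a -> has_deriv (fun s => sin (f s)) t (cos (f t) * a).
Proof. by move=> fa; exact: (@is_derive1_comp _ (@sin R) f). Qed.

(** The search follows the syntax of the function and builds its derivative in an existential
    variable; the form wanted is then compared with it by [ring] or [field]. *)
Ltac derive := repeat first
  [ match goal with H : has_deriv ?f ?t _ |- has_deriv ?f ?t _ => exact: H end
  | match goal with H : forall s, is_true _ -> has_deriv ?f s _
      |- has_deriv ?f ?t _ => apply: H; by [] end
  | exact: has_deriv_cst | exact: has_deriv_id
  | apply: has_deriv_expR | apply: has_deriv_cos | apply: has_deriv_sin
  | apply: has_derivN | apply: has_derivD | apply: has_derivM ].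

Ltac derive_ring := eapply has_deriv_eq; [derive | cbv beta; ring].

(** * Comparison estimates for damped linear equations *)

Lemma derivative_le0_nonincreasing (R : realType) (f df : R -> R) (a b : R) :
  a <= b -> (forall s, a <= s <= b -> has_deriv f s (df s)) ->
  (forall s, a <= s <= b -> df s <= 0) -> f b <= f a.
Proof.
move=> ab fd df0.
have d s : s \in `[a, b]%R -> derivable f s 1.
  by rewrite in_itv /= => /fd [].
apply: (@ler0_derive1_nincr _ f a b) => //.
- by move=> s sab; apply: d; exact: subset_itv_oo_cc sab.
- move=> s /subset_itv_oo_cc; rewrite /= in_itv /= => sab.
  by rewrite derive1E (@derive_val _ _ _ _ _ _ _ (fd _ sab)) df0.
- exact: derivable_within_continuous.
Qed.

(** With the integrating factor [expR (K s)], the function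
    [expR (K s) * (A s - c - (rho s - rho a))] is nonincreasing. Forcing of size [c * k] is balanced
    by the damping and costs only [c], however large the integral of [k], whereas the remainder [r]
    costs its whole integral. *)
Lemma comparison_le (R : realType) (A dA K k rho r : R -> R) (c a b : R) :
  a <= b -> 0 <= c ->
  (forall s, a <= s <= b -> has_deriv A s (dA s)) ->
  (forall s, a <= s <= b -> has_deriv K s (k s)) ->
  (forall s, a <= s <= b -> has_deriv rho s (r s)) ->
  (forall s, a <= s <= b -> 0 <= k s) ->
  (forall s, a <= s <= b -> 0 <= r s) ->
  (forall s, a <= s <= b -> dA s + k s * A s <= c * k s + r s) ->
  A b <= c + (rho b - rho a) + expR (K a - K b) * `|A a|.
Proof.
move=> ab c0 dAs dK drho k0 r0 dAle.
have rhole s : a <= s <= b -> rho a <= rho s.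
  move=> /andP[as_ sb]; rewrite -lerN2.
  apply: (@derivative_le0_nonincreasing _ (fun t => - rho t) (fun t => - r t)) => //.
    move=> t /andP[at_ ts]; apply: has_derivN; apply: drho.
    by rewrite at_ (le_trans ts sb).
  by move=> t /andP[at_ ts]; rewrite oppr_le0 r0 // at_ (le_trans ts sb).
pose B s := expR (K s) * (A s - c - (rho s - rho a)).
have Bd s : a <= s <= b -> has_deriv B s
    (expR (K s) * (dA s - r s) + expR (K s) * k s * (A s - c - (rho s - rho a))).
  move=> sab; rewrite /B.
  have := dAs _ sab; have := dK _ sab; have := drho _ sab => *.
  by derive_ring.
have Bab : B b <= B a.
  apply: derivative_le0_nonincreasing ab Bd _ => s sab.
  have e0 := expR_gt0 (K s).
  rewrite -mulrA -mulrDr pmulr_rle0 //.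
  have := dAle _ sab; have := rhole _ sab; have := k0 _ sab => ks rs.
  have : 0 <= k s * (rho s - rho a) by rewrite mulr_ge0 // subr_ge0.
  by lra.
rewrite -lerBlDl -[leLHS](mulKf (lt0r_neq0 (expR_gt0 (K b)))).
rewrite -expRN expRD mulrAC mulrC ler_pM2r ?expR_gt0 //.
rewrite opprD addrA; apply: le_trans Bab _.
rewrite /B subrr subr0 ler_pM2l ?expR_gt0 //.
by rewrite (le_trans _ (ler_norm _)) // gerBl.
Qed.

Lemma comparison (R : realType) (A dA K k rho r : R -> R) (c a b : R) :
  a <= b -> 0 <= c ->
  (forall s, a <= s <= b -> has_deriv A s (dA s)) ->
  (forall s, a <= s <= b -> has_deriv K s (k s)) ->
  (forall s, a <= s <= b -> has_deriv rho s (r s)) ->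
  (forall s, a <= s <= b -> 0 <= k s) ->
  (forall s, a <= s <= b -> 0 <= r s) ->
  (forall s, a <= s <= b -> `|dA s + k s * A s| <= c * k s + r s) ->
  `|A b| <= c + (rho b - rho a) + expR (K a - K b) * `|A a|.
Proof.
move=> ab c0 dAs dK drho k0 r0 dAle.
rewrite ler_norml lerNl; apply/andP; split; last first.
  apply: comparison_le dAs dK drho _ _ _ => // s sab.
  exact: le_trans (ler_norm _) (dAle _ sab).
rewrite -(normrN (A a)).
apply: (@comparison_le _ (fun s => - A s) (fun s => - dA s) K k rho r) => // s sab.
  by apply: has_derivN; exact: dAs.
by apply: le_trans (dAle _ sab); rewrite mulrN -opprD -normrN ler_norm.
Qed.

(* The rotation through the angle [w * (b - s)] turns the oscillation into
   the identity at [s = b], which reduces the system to the scalar case. *)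
Lemma damped_rotation_bound (R : realType) (X1 X2 g1 g2 K k rho r : R -> R)
    (w c a b : R) :
  a <= b -> 0 <= c ->
  (forall s, a <= s <= b ->
     has_deriv X1 s (- k s * X1 s - w * X2 s + g1 s)) ->
  (forall s, a <= s <= b ->
     has_deriv X2 s (- k s * X2 s + w * X1 s + g2 s)) ->
  (forall s, a <= s <= b -> has_deriv K s (k s)) ->
  (forall s, a <= s <= b -> has_deriv rho s (r s)) ->
  (forall s, a <= s <= b -> 0 <= k s) ->
  (forall s, a <= s <= b -> 0 <= r s) ->
  (forall s, a <= s <= b -> `|g1 s| + `|g2 s| <= c * k s + r s) ->
  `|X2 b| <= c + (rho b - rho a) + expR (K a - K b) * (`|X1 a| + `|X2 a|).
Proof.
move=> ab c0 dX1 dX2 dK drho k0 r0 gle.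
have normM (u y : R) : `|u| <= 1 -> `|u * y| <= `|y|.
  by move=> u1; rewrite normrM ler_piMl.
have cos1 u : `|@cos R u| <= 1 by rewrite ler_norml cos_geN1 cos_le1.
have sin1 u : `|@sin R u| <= 1 by rewrite ler_norml sin_geN1 sin_le1.
pose A s := cos (w * (b - s)) * X2 s + sin (w * (b - s)) * X1 s.
pose G s := cos (w * (b - s)) * g2 s + sin (w * (b - s)) * g1 s.
have dA s : a <= s <= b -> has_deriv A s (G s - k s * A s).
  move=> sab; rewrite /A; have := dX1 _ sab; have := dX2 _ sab => *.
  by rewrite /G; derive_ring.
have -> : X2 b = A b by rewrite /A subrr mulr0 cos0 sin0 mul1r mul0r addr0.
apply: le_trans (comparison ab c0 dA dK drho k0 r0 _) _ => //.
  move=> s sab; rewrite subrK (le_trans _ (gle _ sab)) // addrC.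
  by rewrite (le_trans (ler_normD _ _)) // lerD // normM.
rewrite lerD2l ler_pM2l ?expR_gt0 // addrC.
by rewrite (le_trans (ler_normD _ _)) // lerD // normM.
Qed.

(** * Vanishing at infinity *)

Definition vanishes (R : realType) (f : R -> R) : Prop :=
  forall e, 0 < e -> exists2 T, 0 < T & forall t, T <= t -> `|f t| <= e.

Lemma vanishesP (R : realType) (f : R -> R) :
  f t @[t --> +oo] --> 0 <-> vanishes f.
Proof.
rewrite cvgr0Pnorm_le; split=> fe e /fe.
  move=> [T [_ fT]]; exists (`|T| + 1); first by rewrite ltr_wpDl.
  move=> t Tt; apply: fT; rewrite (le_lt_trans (ler_norm _)) //.
  by rewrite (lt_le_trans _ Tt) // ltrDl.
move=> [T T0 fT]; near=> t; apply: fT; near: t.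
by apply: nbhs_pinfty_ge; exact: num_real.
Unshelve. all: by end_near. Qed.

Lemma vanishesD (R : realType) (f g : R -> R) :
  vanishes f -> vanishes g -> vanishes (fun t => f t + g t).
Proof. by rewrite -!vanishesP => f0 g0; rewrite -[0]addr0; exact: cvgD. Qed.

Lemma vanishesB (R : realType) (f g : R -> R) :
  vanishes f -> vanishes g -> vanishes (fun t => f t - g t).
Proof. by rewrite -!vanishesP => f0 g0; rewrite -[0]subr0; exact: cvgB. Qed.

Lemma vanishes_boundedM (R : realType) (f g : R -> R) (C : R) :
  (forall t, 0 < t -> `|g t| <= C) -> vanishes f ->
  vanishes (fun t => g t * f t).
Proof.
move=> gC f0 e e0.
have C0 : 0 <= C by apply: le_trans (gC _ ltr01).
(* The denominator is [C + 1] because [C] may be [0]. *)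
have [|T T0 fT] := f0 (e / (C + 1)); first by rewrite divr_gt0 // ltr_wpDl.
exists T => // t Tt; rewrite normrM.
have C1 : 0 < C + 1 by rewrite ltr_wpDl.
rewrite -[leRHS](divfK (lt0r_neq0 C1)) mulrC ler_pM // ?fT //.
by rewrite (le_trans (gC _ (lt_le_trans T0 Tt))) // lerDl.
Qed.

Definition diverges (R : realType) (K : R -> R) : Prop :=
  forall M, exists2 T, 0 < T & forall t, T <= t -> M <= K t.

(** Once [K t >= K0 + C / e], the exponential is at most [expR (- (C / e))], and [expR u >= u] at
    [u = C / e] concludes. *)
Lemma expR_diverges_small (R : realType) (K : R -> R) (K0 C e : R) :
  diverges K -> 0 <= C -> 0 < e ->
  exists2 T, 0 < T & forall t, T <= t -> expR (K0 - K t) * C <= e.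
Proof.
move=> Kdvg C0 e0; have [T T0 KT] := Kdvg (K0 + C / e); exists T => // t /KT Kt.
apply: (@le_trans _ _ (expR (- (C / e)) * C)).
  by rewrite ler_wpM2r // ler_expR; lra.
rewrite expRN ler_pdivrMl ?expR_gt0 // -ler_pdivrMr //.
by rewrite (le_trans _ (expR_ge1Dx _)) // lerDr.
Qed.

(** [T] and [C] may depend on [e]: they are fixed before [t] grows, and divergence of [K] then
    brings the transient below [e / 2]. *)
Lemma vanishes_of_decay (R : realType) (A K : R -> R) : diverges K ->
  (forall e, 0 < e -> exists T C, [/\ 0 < T, 0 <= C &
     forall t, T <= t -> `|A t| <= e + expR (K T - K t) * C]) ->
  vanishes A.
Proof.
move=> Kdvg Abnd e e0; have e20 : 0 < e / 2 by rewrite divr_gt0.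
have [T [C [T0 C0 AT]]] := Abnd _ e20.
have [T' T'0 ET'] := expR_diverges_small (K T) Kdvg C0 e20.
exists (Num.max T T'); first by rewrite lt_max T0.
move=> t; rewrite ge_max => /andP[/AT At /ET' Et].
by rewrite (le_trans At) // [leRHS]splitr lerD2l.
Qed.

(** [T] is a point where [rho] is within [e] of its supremum; every later increment fits into that
    gap. *)
Lemma monotone_bounded_tail (R : realType) (rho : R -> R) (B : R) :
  (forall s t, 0 < s -> s <= t -> rho s <= rho t) ->
  (forall t, 0 < t -> rho t <= B) ->
  forall e, 0 < e -> exists2 T, 0 < T &
    forall s t, T <= s -> s <= t -> rho t - rho s <= e.
Proof.
move=> mono bnd e e0; pose X := rho @` [set t | 0 < t].
have supX : has_sup X.
  split; first by exists (rho 1), 1 => //=.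
  by exists B => _ [t t0 <-]; exact: bnd.
have [_ [T T0 <-] rhoT] := sup_adherent e0 supX.
exists T => // s t Ts st; have s0 := lt_le_trans T0 Ts.
have : rho t <= sup X.
  by apply: ub_le_sup; [exact: supX.2 | exists t => //=; exact: lt_le_trans st].
have := mono _ _ T0 Ts; move: rhoT; lra.
Qed.

Lemma vanishes_first_order (R : realType) (A K k h : R -> R) :
  diverges K ->
  (forall t, 0 < t -> has_deriv K t (k t)) ->
  (forall t, 0 < t -> 0 <= k t) ->
  (forall t, 0 < t -> has_deriv A t (- k t * A t + h t)) ->
  (forall e, 0 < e -> exists T c rho r, [/\ 0 < T, 0 <= c,
     forall t, T <= t -> [/\ has_deriv rho t (r t), 0 <= r t &
       `|h t| <= c * k t + r t] &
     forall t, T <= t -> c + (rho t - rho T) <= e]) ->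
  vanishes A.
Proof.
move=> Kdvg dK k0 dA hyp; apply: (vanishes_of_decay Kdvg) => e /hyp.
move=> [T [c [rho [r [T0 c0 hr ce]]]]]; exists T, `|A T|; split=> // t Tt.
apply: (@le_trans _ _ (c + (rho t - rho T) + expR (K T - K t) * `|A T|)); last first.
  by rewrite lerD2r ce.
have pos s : T <= s <= t -> 0 < s by move=> /andP[/(lt_le_trans T0)].
apply: (@comparison _ A (fun s => - k s * A s + h s) K k rho r) => //.
- by move=> s /pos; exact: dA.
- by move=> s /pos; exact: dK.
- by move=> s /andP[/hr[]].
- by move=> s /pos; exact: k0.
- by move=> s /andP[/hr[]].
- by move=> s /andP[/hr[_ _]]; rewrite mulNr addrAC addNr add0r.
Qed.

Lemma diverges_linear (R : realType) (a : R) : 0 < a -> diverges (fun t => a * t).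
Proof.
move=> a0 M; exists (`|M| / a + 1); first by rewrite ltr_wpDl // divr_ge0 // ltW.
move=> t Mt; rewrite -ler_pdivrMl // (le_trans _ Mt) // mulrC.
by rewrite ler_wpDr // ler_wpM2r ?ler_norm // invr_ge0 ltW.
Qed.

Lemma vanishes_filter (R : realType) (a : R) (A h : R -> R) : 0 < a ->
  (forall t, 0 < t -> has_deriv A t (- a * A t + h t)) ->
  vanishes h -> vanishes A.
Proof.
move=> a0 dA h0; have dvg := diverges_linear a0.
apply: (vanishes_first_order dvg _ _ dA) => [t t0|t t0|e e0].
- by derive_ring.
- exact: ltW.
(* Here [k = a], so the bound [e * a] on [h] is [c * k] with [c = e], and the integrable part is
   zero. *)
have [|T T0 hT] := h0 (e * a); first by rewrite mulr_gt0.
exists T, e, (fun=> 0), (fun=> 0); split=> // [|t Tt|t Tt].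
- exact: ltW.
- by split=> //; [exact: has_deriv_cst | rewrite addr0 hT].
- by rewrite subrr addr0.
Qed.

(* The reduced problem: [q = p/2], [u = y1], [y = y2], [z = x - y2] (which is
   twice differentiable even though [x] is not), [z1 = z'], and [I], [J] are the
   two integrals of the damped rotation driven by [y], [I] being the one of the
   theorem. *)
Record damped_system (R : realType) (w q0 B : R)
    (q dq K S u y z z1 I J : R -> R) : Prop := DampedSystem {
  ds_w0 : 0 < w ;
  ds_K : diverges K ;
  ds_q0 : forall t, 0 < t -> 0 < q t <= q0 ;
  ds_dq0 : forall t, 0 < t -> dq t <= 0 ;
  ds_SB : forall t, 0 < t -> S t <= B ;
  ds_dq : forall t, 0 < t -> has_deriv q t (dq t) ;
  ds_dK : forall t, 0 < t -> has_deriv K t (q t) ;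
  ds_dS : forall t, 0 < t -> has_deriv S t (q t ^+ 2) ;
  ds_dy : forall t, 0 < t -> has_deriv y t (u t - w ^+ 2 * y t) ;
  ds_dz : forall t, 0 < t -> has_deriv z t (z1 t) ;
  ds_dz1 : forall t, 0 < t -> has_deriv z1 t
    (- 2 * q t * (z1 t + u t - w ^+ 2 * y t) - w ^+ 2 * (z t + y t)
     + 2 * w ^+ 2 * u t - w ^+ 4 * y t) ;
  ds_dI : forall t, 0 < t -> has_deriv I t
    (- q t * I t + w * J t + 2 * w ^+ 2 * y t) ;
  ds_dJ : forall t, 0 < t -> has_deriv J t
    (- q t * J t - w * I t + (w ^+ 3 - w) * y t)
}.

(** * Asymptotics of the reduced system *)

Section DampedSystem.
Context (R : realType) (w q0 B : R) (q dq K S u y z z1 I J : R -> R).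
Context (ds : damped_system w q0 B q dq K S u y z z1 I J).

Let w0 := ds_w0 ds.
Let dK := ds_dK ds.
Let dq' := ds_dq ds.
Let dS := ds_dS ds.
Let dy := ds_dy ds.
Let dz := ds_dz ds.
Let dz1 := ds_dz1 ds.
Let dI := ds_dI ds.
Let dJ := ds_dJ ds.

Let x t := z t + y t.

Let q_ge0 t : 0 < t -> 0 <= q t.
Proof. by move/(ds_q0 ds) => /andP[/ltW]. Qed.

Let q_leq0 t : 0 < t -> q t <= q0.
Proof. by move/(ds_q0 ds) => /andP[]. Qed.

Let q0_ge0 : 0 <= q0.
Proof. exact: le_trans (q_ge0 ltr01) (q_leq0 ltr01). Qed.

(* As [(d/dt + w^2)^2 z = (2 w^2 - p) x' + (w^4 - w^2) x], subtracting
   [(2 w^2 - p) x] from [(d/dt + w^2) z] removes [x'] from its equation. *)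
Lemma vanishes_y_of_x : vanishes x -> vanishes y.
Proof.
move=> x0; pose a := w ^+ 2.
have a0 : 0 < a by rewrite exprn_gt0.
pose m t := z1 t + a * z t - (2 * a - 2 * q t) * x t.
have dm t : 0 < t -> has_deriv m t
    (- a * m t + ((- a - a ^+ 2 + 2 * a * q t) * x t + 2 * dq t * x t)).
  by move=> t0; rewrite /m /x /a; derive_ring.
have m0 : vanishes m.
  apply: (vanishes_first_order (diverges_linear a0) _ _ dm).
  - by move=> t _; derive_ring.
  - by move=> t _; exact: ltW.
  (* The bounded coefficient of [x] is at most [a * C], which the damping [a] turns into [C]; the
     integral of [2 * |dq|] is at most [2 * q0]. With [|x| <= d] both together cost
     [(C + 2 * q0) * d = e]. *)
  move=> e e0; have q0p := q0_ge0; pose C := 1 + a + 2 * q0.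
  have C0 : 0 < C by rewrite /C; lra.
  pose d := e / (C + 2 * q0).
  have d0 : 0 < d by rewrite divr_gt0 //; lra.
  have [T T0 xT] := x0 _ d0.
  exists T, (C * d), (fun t => - 2 * d * q t), (fun t => - 2 * d * dq t).
  split; [exact: T0 | by rewrite mulr_ge0 // ltW | move=> t Tt | move=> t Tt].
    have t0 := lt_le_trans T0 Tt; split.
    - by derive_ring.
    - by rewrite mulNr mulNr oppr_ge0 mulr_ge0_le0 // ?(ds_dq0 ds) // mulr_ge0 // ltW.
    - have dqt := ds_dq0 ds t0; have := q_ge0 t0; have := q_leq0 t0 => qt1 qt0.
      rewrite (le_trans (ler_normD _ _)) // lerD //.
        rewrite normrM [leRHS]mulrAC ler_pM ?xT //.
        have : `|- a - a ^+ 2 + 2 * a * q t| <= a + a ^+ 2 + 2 * a * q0.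
          have : 0 <= a * q t <= a * q0.
            by rewrite mulr_ge0 ?(ltW a0) //= ler_pM2l.
          by have := sqr_ge0 a; rewrite ler_norml; lra.
        by move/le_trans; apply; rewrite /C expr2; lra.
      rewrite normrM (_ : `|2 * dq t| = - 2 * dq t); last first.
        by rewrite ler0_norm ?mulNr // pmulr_rle0.
      by rewrite [leRHS]mulrAC ler_wpM2l ?xT //; lra.
  have t0 := lt_le_trans T0 Tt.
  apply: (@le_trans _ _ ((C + 2 * q0) * d)).
    have : 0 <= d * q t by rewrite mulr_ge0 ?q_ge0 // ltW.
    have : d * q T <= d * q0 by rewrite ler_pM2l ?q_leq0.
    by lra.
  by rewrite /d mulrC divfK //; lra.
(* By definition of [m], [(d/dt + a) z = m + (2 * a - 2 * q) * x], whose right-hand side vanishes: a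
   second first-order filter. *)
have z0 : vanishes z.
  apply: (@vanishes_filter _ a z (fun t => m t + (2 * a - 2 * q t) * x t)) => //.
    by move=> t t0; apply: has_deriv_eq (dz t0) _; rewrite /m; ring.
  apply: vanishesD m0 _; apply: (@vanishes_boundedM _ _ _ (2 * a + 2 * q0)) => //.
  move=> t t0; have := q_ge0 t0; have := q_leq0 t0; have := q0_ge0 => *.
  by rewrite ler_norml; lra.
have -> : y = (fun t => x t - z t) by apply/funext => t; rewrite /x; lra.
exact: vanishesB.
Qed.

Let D2 t := z t - I t.
(** The last term absorbs the multiple [(2 * w - 2 * q / w) * y'] in the derivative of [z1 / w], so
    that the forcing terms [g1] and [g2] contain [y] but not [y']. *)
Let D1 t := (z1 t + q t * z t) / w - J t - (2 * w - 2 * q t / w) * y t.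
(** A primitive of [|dq| + q ^+ 2], the integrable weight that [z] carries in [g1]. *)
Let rho t := - q t + S t.

Let drho t : 0 < t -> has_deriv rho t (- dq t + q t ^+ 2).
Proof. by move=> t0; rewrite /rho; derive_ring. Qed.

Let rho_mono s t : 0 < s -> s <= t -> rho s <= rho t.
Proof.
move=> s0 st; rewrite -lerN2.
have pos r : s <= r <= t -> 0 < r by move=> /andP[/(lt_le_trans s0)].
apply: (@derivative_le0_nonincreasing _ (fun r => - rho r)
  (fun r => - (- dq r + q r ^+ 2))) => // r /pos r0.
  by apply: has_derivN; exact: drho.
by have := ds_dq0 ds r0; have := sqr_ge0 (q r); lra.
Qed.

(** The total weight of [y]: [2] from [g2], [2 * w + 2 * q0 / w] from the first term of [g1], and at
    most [2 * q0 / w] from the integral of [2 * |dq| / w]; this leaves [2 * q0 / w] to spare. *)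
Let C0 := 2 + 2 * w + 4 * q0 / w + 2 * q0 / w.

Let g1 t := - q t * (2 * w - 2 * q t / w) * y t
  + (dq t + q t ^+ 2) * z t / w + 2 * dq t * y t / w.
Let g2 t := - 2 * q t * y t.

Let dD1 t : 0 < t -> has_deriv D1 t (- q t * D1 t - w * D2 t + g1 t).
Proof.
move=> t0; have wn0 := lt0r_neq0 w0; rewrite /D1 /D2 /g1.
by eapply has_deriv_eq; [derive | cbv beta; field].
Qed.

Let dD2 t : 0 < t -> has_deriv D2 t (- q t * D2 t + w * D1 t + g2 t).
Proof.
move=> t0; have wn0 := lt0r_neq0 w0; rewrite /D1 /D2 /g2.
by eapply has_deriv_eq; [derive | cbv beta; field].
Qed.

(** The bounds on [y] and [z] are kept apart because [M] is multiplied only by an increment of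
    [rho], which is small for late [T] even when [z] is merely bounded. *)
Let D2_bound (e M T t : R) : 0 < T -> T <= t -> 0 <= e -> 0 <= M ->
  (forall s, T <= s <= t -> `|y s| <= e) ->
  (forall s, T <= s <= t -> `|z s| <= M) ->
  `|D2 t| <= C0 * e + M / w * (rho t - rho T)
             + expR (K T - K t) * (`|D1 T| + `|D2 T|).
Proof.
move=> T0 Tt e0 M0 ye zM.
have pos s : T <= s <= t -> 0 < s by move=> /andP[/(lt_le_trans T0)].
have wV : 0 < w^-1 by rewrite invr_gt0.
pose c := (2 + 2 * w + 2 * q0 / w) * e.
(* In [sg], the term in [q] pays for [2 * dq * y / w], and the term in [rho] for
   [(dq + q ^+ 2) * z / w]. *)
pose sg s := - 2 * e / w * q s + M / w * rho s.
pose r s := - 2 * e / w * dq s + M / w * (- dq s + q s ^+ 2).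
have c0 : 0 <= c.
  rewrite mulr_ge0 // ?addr_ge0 // ?mulr_ge0 // ?(ltW wV) ?(ltW w0) //.
apply: (@le_trans _ _ (c + (sg t - sg T) + expR (K T - K t) * (`|D1 T| + `|D2 T|))).
  have H s : T <= s <= t -> 0 <= - dq s + q s ^+ 2.
    by move=> /pos s0; have := ds_dq0 ds s0; have := sqr_ge0 (q s); lra.
  have H2 s : T <= s <= t -> 0 <= 2 * e / w * - dq s.
    move=> /pos s0; rewrite !mulr_ge0 ?(ltW wV) //.
    by rewrite oppr_ge0 (ds_dq0 ds).
  apply: (@damped_rotation_bound _ D1 D2 g1 g2 K q sg r w _ _ _ Tt c0) => s sTt.
  - exact: dD1 (pos _ sTt).
  - exact: dD2 (pos _ sTt).
  - exact: dK (pos _ sTt).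
  - have s0 := pos _ sTt; have ds' := drho s0.
    by rewrite /sg /r; derive_ring.
  - exact: q_ge0 (pos _ sTt).
  - have := H2 _ sTt; have : 0 <= M / w * (- dq s + q s ^+ 2).
      by rewrite mulr_ge0 ?H // mulr_ge0 // ltW.
    by rewrite /r; move: (M / w * _) => X; lra.
  - have s0 := pos _ sTt; have qs0 := q_ge0 s0; have qs1 := q_leq0 s0.
    have b2 : `|g2 s| <= 2 * q s * e.
      rewrite /g2 !normrM normrN (ger0_norm qs0) normr_nat.
      by rewrite ler_wpM2l ?ye // mulr_ge0.
    have b1 : `|- q s * (2 * w - 2 * q s / w) * y s|
        <= q s * (2 * w + 2 * q0 / w) * e.
      rewrite !normrM normrN (ger0_norm qs0) ler_pM ?ye //.
        by rewrite mulr_ge0.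
      rewrite ler_wpM2l //.
      have : 0 <= q s / w <= q0 / w.
        by rewrite mulr_ge0 ?(ltW wV) //= ler_pM2r.
      by rewrite ler_norml; have := w0; lra.
    have b3 : `|(dq s + q s ^+ 2) * z s / w| <= M / w * (- dq s + q s ^+ 2).
      rewrite !normrM (gtr0_norm wV) [leRHS]mulrAC ler_pM2r //.
      rewrite [leRHS]mulrC ler_pM ?zM // (le_trans (ler_normD _ _)) //.
      by rewrite ler0_norm ?(ds_dq0 ds) // ger0_norm ?sqr_ge0.
    have b4 : `|2 * dq s * y s / w| <= 2 * e / w * - dq s.
      rewrite !normrM (gtr0_norm wV) normr_nat (ler0_norm (ds_dq0 ds s0)).
      rewrite [leRHS]mulrAC ler_pM2r // mulrAC -!mulrA ler_pM2l //.
      by rewrite ler_wpM2r ?ye // oppr_ge0 (ds_dq0 ds).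
    have : `|g1 s| <= q s * (2 * w + 2 * q0 / w) * e
        + M / w * (- dq s + q s ^+ 2) + 2 * e / w * - dq s.
      rewrite /g1 (le_trans (ler_normD _ _)) // lerD //.
      by rewrite (le_trans (ler_normD _ _)) // lerD.
    move: b2; rewrite /r /c; move: (M / w * _) => X.
    by lra.
rewrite lerD2r /c /sg /C0.
have : 0 <= 2 * e / w * q t by rewrite !mulr_ge0 ?(ltW wV) ?q_ge0 ?(lt_le_trans T0 Tt).
have : 2 * e / w * q T <= 2 * e / w * q0.
  by rewrite ler_wpM2l ?q_leq0 // !mulr_ge0 ?(ltW wV).
move: (rho t) (rho T) => r1 r2; rewrite mulrBr.
have : 0 <= q0 / w * e by rewrite !mulr_ge0 ?(ltW wV).
by lra.
Qed.

Let K_mono s t : 0 < s -> s <= t -> K s <= K t.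
Proof.
move=> s0 st; rewrite -lerN2.
have pos r : s <= r <= t -> 0 < r by move=> /andP[/(lt_le_trans s0)].
apply: (@derivative_le0_nonincreasing _ (fun r => - K r) (fun r => - q r)) => //.
  by move=> r /pos r0; apply: has_derivN; exact: dK.
by move=> r /pos r0; rewrite oppr_le0 q_ge0.
Qed.

Let rho_tail e : 0 < e ->
  exists2 T, 0 < T & forall s t, T <= s -> s <= t -> rho t - rho s <= e.
Proof.
apply: (@monotone_bounded_tail _ rho B) => // t t0.
by have := ds_SB ds t0; have := q_ge0 t0; rewrite /rho; lra.
Qed.

Let C0_gt0 : 0 < C0.
Proof.
have wV : 0 < w^-1 by rewrite invr_gt0.
have : 0 <= q0 / w by rewrite mulr_ge0 // ltW.
by have := w0; rewrite /C0; lra.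
Qed.

(** The extreme value theorem is applied to [z * z], which, unlike the absolute value, inherits
    differentiability from [z]. *)
Let max_abs_z T t : 0 < T -> T <= t ->
  exists2 c, T <= c <= t & forall s, T <= s <= t -> `|z s| <= `|z c|.
Proof.
move=> T0 Tt; have cz : {within `[T, t], continuous (fun s => z s * z s)}.
  apply: derivable_within_continuous => s; rewrite in_itv /= => /andP[Ts _].
  have s0 := lt_le_trans T0 Ts.
  have : has_deriv (fun s => z s * z s) s (z s * z1 s + z s * z1 s) by derive.
  by case.
have [c] := EVT_max Tt cz; rewrite in_itv /= => cTt zc; exists c => // s sTt.
rewrite -ler_sqr ?nnegrE // !real_normK ?num_real // !expr2.
by apply: zc; rewrite in_itv.
Qed.

(** A bootstrap: at a point [c] of [[T, t]] where [|z|] is largest, [D2_bound] holds with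
    [M = |z c|]. As [rho] increases by at most [w / 2] after [T], this gives
    [|z c| <= 1 + C0 + C + |z c| / 2], and the last term is absorbed; the bound obtained does not
    depend on [t]. *)
Let z_bounded : vanishes y -> vanishes I ->
  exists M T, [/\ 0 <= M, 0 < T & forall t, T <= t -> `|z t| <= M].
Proof.
move=> y0 I0.
have [T1 T10 yT] := y0 _ ltr01; have [T2 T20 IT] := I0 _ ltr01.
have [|T3 T30 rT] := @rho_tail (w / 2); first by rewrite divr_gt0.
pose T := Num.max T1 (Num.max T2 T3).
have T0 : 0 < T by rewrite lt_max T10.
have leT t : T <= t -> [/\ T1 <= t, T2 <= t & T3 <= t].
  by rewrite !ge_max => /andP[-> /andP[-> ->]].
pose C := `|D1 T| + `|D2 T|.
have C_ge0 : 0 <= C by rewrite addr_ge0.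
exists (2 * (1 + C0 + C)), T; split; last 2 first.
- exact: T0.
- move=> t Tt; have [c /andP[Tc ct] zc] := max_abs_z T0 Tt.
  apply: (le_trans (zc t _)); first by rewrite Tt lexx.
  have zbnd s : T <= s <= c -> `|z s| <= `|z c|.
    by move=> /andP[Ts sc]; apply: zc; rewrite Ts (le_trans sc).
  have ybnd s : T <= s <= c -> `|y s| <= 1.
    by move=> /andP[/leT[Ts _ _] _]; exact: yT.
  have := D2_bound T0 Tc ler01 (normr_ge0 (z c)) ybnd zbnd.
  have Ic : `|I c| <= 1 by have [_ cT2 _] := leT _ Tc; exact: IT.
  have rc : rho c - rho T <= w / 2 by apply: rT => //; have [] := leT T (lexx T).
  have : `|z c| / w * (rho c - rho T) <= `|z c| / 2.
    rewrite -mulrA ler_wpM2l // ler_pdivrMl // mulrC; move: rc; lra.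
  have : expR (K T - K c) * C <= C.
    by rewrite ler_piMl // -expR0 ler_expR subr_le0 K_mono.
  have : `|z c| <= `|D2 c| + `|I c|.
    by rewrite (le_trans _ (ler_normD _ _)) // /D2 subrK.
  rewrite -/C; move: (expR _ * C) (`|z c| / w * _) => X1 X2; lra.
- by have := C0_gt0; lra.
Qed.

Let D2_vanishes M T1 : vanishes y -> 0 <= M -> 0 < T1 ->
  (forall t, T1 <= t -> `|z t| <= M) -> vanishes D2.
Proof.
move=> y0 M0 T10 zM; apply: (vanishes_of_decay (ds_K ds)) => e e0.
(* Half of [e] goes to the term in [y] and half to the term in [z]; [M + 1] keeps the second
   denominator positive. *)
have [|T2 T20 yT] := y0 (e / (2 * C0)).
  by rewrite divr_gt0 // mulr_gt0 // C0_gt0.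
have [|T3 T30 rT] := @rho_tail (e * w / (2 * (M + 1))).
  by rewrite divr_gt0 ?mulr_gt0 // ltr_wpDl.
pose T := Num.max T1 (Num.max T2 T3).
have T0 : 0 < T by rewrite lt_max T10.
have leT t : T <= t -> [/\ T1 <= t, T2 <= t & T3 <= t].
  by rewrite !ge_max => /andP[-> /andP[-> ->]].
exists T, (`|D1 T| + `|D2 T|); split=> [||t Tt]; first exact: T0.
  by rewrite addr_ge0.
have C0n := lt0r_neq0 C0_gt0.
have ec : 0 <= e / (2 * C0) by rewrite divr_ge0 ?ltW // mulr_gt0 // C0_gt0.
have ybnd s : T <= s <= t -> `|y s| <= e / (2 * C0).
  by move=> /andP[/leT[_ Ts _] _]; exact: yT.
have zbnd s : T <= s <= t -> `|z s| <= M.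
  by move=> /andP[/leT[Ts _ _] _]; exact: zM.
apply: le_trans (D2_bound T0 Tt ec M0 ybnd zbnd) _.
rewrite lerD2r (_ : C0 * _ = e / 2); last by field.
have rt : rho t - rho T <= e * w / (2 * (M + 1)).
  by apply: rT => //; have [] := leT T (lexx T).
suff : M / w * (rho t - rho T) <= e / 2 by lra.
apply: (@le_trans _ _ (M / w * (e * w / (2 * (M + 1))))).
  by rewrite ler_wpM2l // divr_ge0 // ltW.
have M1 : 0 < M + 1 by rewrite ltr_wpDl.
rewrite (_ : _ * _ = M / (M + 1) * (e / 2)); last first.
  by field; rewrite (lt0r_neq0 M1) (lt0r_neq0 w0).
rewrite ler_piMl //; first by rewrite divr_ge0 // ltW.
by rewrite ler_pdivrMr // mul1r lerDl.
Qed.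

(** Either way [z - I] vanishes once [z] is eventually bounded. Forwards, [z = x - y] even vanishes;
    backwards, boundedness comes from the bootstrap. *)
Lemma damped_system_vanishes : vanishes x <-> vanishes y /\ vanishes I.
Proof.
split=> [x0|[y0 I0]].
  have y0 := vanishes_y_of_x x0; split=> //.
  have z0 : vanishes z.
    have -> : z = (fun t => x t - y t) by apply/funext => t; rewrite /x addrK.
    exact: vanishesB.
  have [T T0 zT] := z0 _ ltr01.
  have -> : I = (fun t => z t - D2 t).
    by apply/funext => t; rewrite /D2 opprB addrC subrK.
  by apply: vanishesB => //; exact: D2_vanishes y0 ler01 T0 zT.
have [M [T [M0 T0 zT]]] := z_bounded y0 I0.
apply: vanishesD => //.
have -> : z = (fun t => D2 t + I t) by apply/funext => t; rewrite /D2 subrK.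
by apply: vanishesD => //; exact: D2_vanishes y0 M0 T0 zT.
Qed.

End DampedSystem.

(** * Continuity and local integrability on the half-line *)

Definition continuous_ge0 (R : realType) (f : R -> R) : Prop :=
  forall T, 0 < T -> {within `[0, T], continuous f}.

Lemma continuous_ge0_itv (R : realType) (f : R -> R) :
  {within `[0, +oo[, continuous f} -> continuous_ge0 f.
Proof.
move=> cf T T0; apply: continuous_subspaceW cf => s /=.
by rewrite !in_itv /= => /andP[->].
Qed.

Lemma continuous_ge0_total (R : realType) (f : R -> R) :
  continuous f -> continuous_ge0 f.
Proof. by move=> cf T _; exact: continuous_subspaceT. Qed.

Lemma continuous_ge0_at (R : realType) (f : R -> R) (t : R) :
  continuous_ge0 f -> 0 < t -> {for t, continuous f}.
Proof.
move=> cf t0; have t1 : 0 < t + 1 by rewrite ltr_wpDl // ltW.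
apply: within_continuous_continuous t1 (cf _ t1) _.
by rewrite in_itv /= t0 ltrDl ltr01.
Qed.

Lemma continuous_ge0M (R : realType) (f g : R -> R) :
  continuous_ge0 f -> continuous_ge0 g -> continuous_ge0 (fun t => f t * g t).
Proof. by move=> cf cg T T0 t; apply: cvgM; [exact: cf | exact: cg]. Qed.

Lemma continuous_ge0D (R : realType) (f g : R -> R) :
  continuous_ge0 f -> continuous_ge0 g -> continuous_ge0 (fun t => f t + g t).
Proof. by move=> cf cg T T0 t; apply: cvgD; [exact: cf | exact: cg]. Qed.

Lemma continuous_ge0_comp (R : realType) (f g : R -> R) :
  continuous g -> continuous_ge0 f -> continuous_ge0 (fun t => g (f t)).
Proof.
by move=> cg cf T T0 t; apply: (continuous_comp (cf _ T0 t)); exact: cg.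
Qed.

Lemma has_deriv_continuous (R : realType) (f df : R -> R) :
  (forall t, has_deriv f t (df t)) -> continuous f.
Proof.
move=> fd t; apply/differentiable_continuous; rewrite -derivable1_diffP.
by case: (fd t).
Qed.

Lemma L1loc_integrable (R : realType) (f : R -> R) (T : R) : L1loc f ->
  lebesgue_measure.-integrable `[0, T] (EFin \o f).
Proof.
move=> lf; have [|T0] := leP 0 T; first exact: lf.
by rewrite set_itv_ge ?bnd_simp -?ltNge //; exact: integrable_set0.
Qed.

Lemma continuous_ge0_L1loc (R : realType) (f : R -> R) :
  continuous_ge0 f -> L1loc f.
Proof.
(* [T] may be [0], where [continuous_ge0] gives nothing directly; hence the larger segment up to
   [T + 1]. *)
move=> cf T T0; have T1 : 0 < T + 1 by rewrite ltr_wpDl.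
apply: (@integrableS _ _ _ lebesgue_measure `[0, T + 1]) => //.
  by apply: subset_itvl; rewrite bnd_simp lerDl.
by apply: continuous_compact_integrable (cf _ T1); exact: segment_compact.
Qed.

Lemma L1locM (R : realType) (h f : R -> R) :
  continuous_ge0 h -> L1loc f -> L1loc (fun t => h t * f t).
Proof.
move=> ch lf T T0; have T1 : 0 < T + 1 by rewrite ltr_wpDl.
have sub : (`[0, T]%classic : set R) `<=` `[0, T + 1]%classic.
  by apply: subset_itvl; rewrite bnd_simp lerDl.
have cT : {within `[0, T], continuous h} := continuous_subspaceW sub (ch _ T1).
have -> : EFin \o (fun t => h t * f t) = ((EFin \o h) \* (EFin \o f))%E by [].
apply: integrableMr (lf _ T0); first exact: measurable_itv.
  exact: measurable_realfun.subspace_continuous_measurable_fun cT.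
have /compact_bounded[M [_ mrt]] :=
  continuous_compact cT (@segment_compact _ 0 T).
by exists M; split; rewrite ?num_real // => ? ? ? ?; exact: mrt.
Qed.

Lemma L1loc_norm (R : realType) (f : R -> R) :
  L1loc f -> L1loc (fun t => `|f t|).
Proof. by move=> lf T T0; apply: integrable_norm; exact: lf. Qed.

(** * Primitives of continuous and of merely integrable functions *)

Lemma continuous_ge0_int (R : realType) (f : R -> R) :
  L1loc f -> continuous_ge0 (fun t => Icc_int 0 t f).
Proof.
move=> lf T T0; apply: parameterized_integral_continuous (ltW T0) _.
exact: L1loc_integrable.
Qed.

Lemma has_deriv_int (R : realType) (f : R -> R) (t : R) :
  L1loc f -> 0 < t -> {for t, continuous f} ->
  has_deriv (fun s => Icc_int 0 s f) t (f t).
Proof.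
move=> lf t0 ft; have tt1 : t < t + 1 by rewrite ltrDl.
have [d dE] := continuous_FTC1_closed tt1 (L1loc_integrable _ lf) t0 ft.
by apply: DeriveDef; [exact: d | rewrite -derive1E].
Qed.

Lemma has_deriv_int_continuous (R : realType) (f : R -> R) (t : R) :
  continuous_ge0 f -> 0 < t -> has_deriv (fun s => Icc_int 0 s f) t (f t).
Proof.
move=> cf t0; apply: has_deriv_int => //; first exact: continuous_ge0_L1loc.
exact: continuous_ge0_at.
Qed.

Lemma eq_Icc_int (R : realType) (a b : R) (f g : R -> R) :
  (forall s, a <= s <= b -> f s = g s) -> Icc_int a b f = Icc_int a b g.
Proof.
by move=> fg; apply: eq_Rintegral => s; rewrite inE /= in_itv /=; exact: fg.
Qed.

Lemma Icc_int_Zl (R : realType) (f : R -> R) (c t : R) : L1loc f ->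
  Icc_int 0 t (fun s => c * f s) = c * Icc_int 0 t f.
Proof. by move=> lf; apply: RintegralZl => //; exact: L1loc_integrable. Qed.

Lemma Icc_int_D (R : realType) (f g : R -> R) (t : R) : L1loc f -> L1loc g ->
  Icc_int 0 t (fun s => f s + g s) = Icc_int 0 t f + Icc_int 0 t g.
Proof.
by move=> lf lg; apply: RintegralD => //; exact: L1loc_integrable.
Qed.

Lemma Icc_int_cat (R : realType) (f : R -> R) (s t : R) : L1loc f ->
  0 <= s -> s <= t ->
  Icc_int 0 t f - Icc_int 0 s f = \int[lebesgue_measure]_(r in `]s, t]) f r.
Proof.
move=> lf s0 st; apply: Rintegral_itvB; rewrite ?bnd_simp //.
exact: L1loc_integrable.
Qed.

(** The increment of [G] is [o(s - t)]. This serves at points where an integrand is only integrable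
    and the fundamental theorem of calculus does not apply. *)
Lemma has_deriv0_dominated (R : realType) (G H : R -> R) (t : R) :
  (\forall s \near t, `|G s - G t| <= `|s - t| * H s) ->
  H s @[s --> t] --> 0 -> has_deriv G t 0.
Proof.
move=> GH H0.
have lim0 : h^-1 *: ((G \o shift t) (h *: 1) - G t) @[h --> 0^'] --> (0 : R).
  apply/cvgr0Pnorm_le => e e0.
  have He : \forall s \near t, `|H s| <= e
    by move/cvgr0Pnorm_le : H0; apply.
  have near0 (P : R -> Prop) : (\forall s \near t, P s) ->
      \forall h \near 0^', P (h + t).
    move=> Pt; apply: cvg_within.
    have : h + t @[h --> (0 : R)] --> 0 + t.
      by apply: cvgD; [exact: cvg_id | exact: cvg_cst].
    by rewrite add0r; apply.
  near=> h.
  have hn0 : h != 0 by near: h; exact: nbhs_dnbhs_neq.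
  have Gh : `|G (h + t) - G t| <= `|h + t - t| * H (h + t).
    by near: h; exact: (near0 _ GH).
  have Hh : `|H (h + t)| <= e by near: h; exact: (near0 _ He).
  rewrite /= /GRing.scale /= mulr1 normrM normfV ler_pdivrMl ?normr_gt0 //.
  rewrite (le_trans Gh) // addrK ler_wpM2l //.
  exact: le_trans (ler_norm _) Hh.
apply: DeriveDef; first by apply/cvg_ex; exists 0.
exact: cvg_lim lim0.
Unshelve. all: by end_near. Qed.

Lemma Icc_int_increment (R : realType) (f g : R -> R) (c s t : R) :
  L1loc f -> L1loc g -> 0 <= s -> s <= t ->
  (forall r, s <= r <= t -> `|g r| <= c * `|f r|) ->
  `|Icc_int 0 t g - Icc_int 0 s g| <=
    c * (Icc_int 0 t (fun r => `|f r|) - Icc_int 0 s (fun r => `|f r|)).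
Proof.
move=> lf lg s0 st gf; have lnf := L1loc_norm lf.
have sub h : L1loc h -> lebesgue_measure.-integrable `]s, t] (EFin \o h).
  move=> lh; apply: integrableS (L1loc_integrable t lh) => //.
  by apply: subset_itvr; rewrite bnd_simp.
rewrite !Icc_int_cat // -RintegralZl //; last exact: sub.
apply: le_trans (le_normr_Rintegral _ _) _ => //; first exact: sub.
apply: le_Rintegral => //.
- by apply: integrable_norm; exact: sub.
- by apply: (sub (fun r => c * `|f r|)); apply: L1locM => //;
    apply: continuous_ge0_total; exact: cst_continuous.
- by move=> r /=; rewrite in_itv /= => /andP[/ltW sr rt]; apply: gf; rewrite sr.
Qed.

(** For [v <= u], the tangent inequality [1 + (v - u) <= expR (v - u)], multiplied by [expR u],
    bounds the difference by [expR u * (u - v)]. *)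
Lemma expR_lipschitz (R : realType) (u v b : R) : u <= b -> v <= b ->
  `|expR u - expR v| <= expR b * `|u - v|.
Proof.
wlog vu : u v / v <= u.
  move=> h ub vb; have [/h|/ltW/h] := leP v u; first exact.
  by rewrite distrC (distrC u); exact.
move=> ub _; rewrite !ger0_norm ?subr_ge0 ?ler_expR //.
apply: (@le_trans _ _ (expR u * (u - v))); last first.
  by rewrite ler_wpM2r ?subr_ge0 // ler_expR.
have := expR_ge1Dx (v - u); rewrite -(ler_pM2l (expR_gt0 u)) -expRD (addrC u) subrK.
by lra.
Qed.

(** Formally, [expR (a * t) * f t] arises from both terms and cancels. Since [f] is only locally
    integrable, neither term need be differentiable at [t], so the cancellation is carried out on
    increments. *)
Lemma has_deriv_int_parts (R : realType) (f : R -> R) (a t : R) :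
  L1loc f -> 0 <= a -> 0 < t ->
  has_deriv (fun s => Icc_int 0 s (fun r => expR (a * r) * f r)
                      - expR (a * s) * Icc_int 0 s f) t
    (- (a * expR (a * t) * Icc_int 0 t f)).
Proof.
move=> lf a0 t0.
have dexp s : has_deriv (fun r => expR (a * r)) s (a * expR (a * s)).
  by derive_ring.
have cexp : continuous_ge0 (fun r => expR (a * r)).
  exact: continuous_ge0_total (has_deriv_continuous dexp).
have ccst (c : R) : continuous_ge0 (fun=> c).
  by apply: continuous_ge0_total; exact: cst_continuous.
pose g r := (expR (a * r) - expR (a * t)) * f r.
have lg : L1loc g by apply: L1locM lf; exact: continuous_ge0D cexp (ccst _).
pose F s := Icc_int 0 s f.
pose Phi s := Icc_int 0 s (fun r => `|f r|).
(* The factor of [f] in [g] is zero at [t] and Lipschitz up to [t + 1], so an increment of the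
   integral is at most a constant times [|s - t| * |Phi s - Phi t|], and [Phi] is continuous. The
   bound [gle] on [[lo, hi]] serves both orders of [s] and [t]. *)
have G0 : has_deriv (fun s => Icc_int 0 s g) t 0.
  pose H s := a * expR (a * (t + 1)) * `|Phi s - Phi t|.
  apply: (@has_deriv0_dominated _ _ H).
    near=> s.
    have s0 : 0 <= s by near: s; exact: lt_le_nbhsr.
    have s1 : s <= t + 1 
      by apply: ltW; near: s; apply: lt_nbhsl; rewrite ltrDl.
    have gle r (lo hi : R) : lo <= r <= hi -> lo <= t <= hi -> hi <= t + 1 ->
        `|g r| <= (a * expR (a * (t + 1)) * (hi - lo)) * `|f r|.
      move=> /andP[lr rh] /andP[lt th] h1; rewrite normrM ler_wpM2r //.
      apply: le_trans (@expR_lipschitz _ _ _ (a * (t + 1)) _ _) _.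
      - by rewrite ler_wpM2l // (le_trans rh).
      - by rewrite ler_wpM2l // lerDl.
      rewrite -mulrBr normrM (ger0_norm a0) mulrA [_ * a]mulrC ler_wpM2l //.
        by rewrite mulr_ge0 // expR_ge0.
      by rewrite ler_norml; lra.
    have E0 : 0 <= a * expR (a * (t + 1)) by rewrite mulr_ge0 // expR_ge0.
    have [ts|/ltW st] := leP t s.
      apply: (@le_trans _ _ ((a * expR (a * (t + 1)) * (s - t)) * (Phi s - Phi t))).
        apply: Icc_int_increment => //; first exact: ltW.
        by move=> r rts; apply: gle => //; rewrite lexx ts.
      rewrite (ger0_norm (_ : 0 <= s - t)) ?subr_ge0 // /H mulrA [_ * (a * _)]mulrC.
      by rewrite ler_wpM2l ?ler_norm // mulr_ge0 // subr_ge0.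
    rewrite distrC; apply: (@le_trans _ _
        ((a * expR (a * (t + 1)) * (t - s)) * (Phi t - Phi s))).
      apply: Icc_int_increment => // r rts; apply: gle => //.
        by rewrite st lexx.
      by rewrite lerDl.
    rewrite distrC (ger0_norm (_ : 0 <= t - s)) ?subr_ge0 // /H distrC mulrA.
    rewrite [_ * (a * _)]mulrC.
    by rewrite ler_wpM2l ?ler_norm // mulr_ge0 // subr_ge0.
  have cPhi : Phi s @[s --> t] --> Phi t.
    by apply: continuous_ge0_at t0; apply: continuous_ge0_int; exact: L1loc_norm.
  have : H s @[s --> t] --> a * expR (a * (t + 1)) * `|Phi t - Phi t|.
    apply: cvgM; first exact: cvg_cst.
    by apply: cvg_norm; apply: cvgB cPhi (cvg_cst _).
  by rewrite subrr normr0 mulr0.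
have cF : F s @[s --> t] --> F t.
  by apply: continuous_ge0_at t0; exact: continuous_ge0_int.
(* With [psi s = exp (a s)], [int psi f - psi F] equals
   [int (psi - psi(t)) f - (psi - psi(t)) (F - F(t)) - (psi - psi(t)) F(t)],
   whose first two terms have zero derivative at [t]. *)
have P0 : has_deriv
    (fun s => (expR (a * s) - expR (a * t)) * (F s - F t)) t 0.
  pose H s := expR (a * (t + 1)) * a * `|F s - F t|.
  apply: (@has_deriv0_dominated _ _ H).
    near=> s.
    have s1 : s <= t + 1 
      by apply: ltW; near: s; apply: lt_nbhsl; rewrite ltrDl.
    rewrite !subrr mul0r subr0 normrM /H mulrA ler_wpM2r //.
    apply: le_trans (@expR_lipschitz _ _ _ (a * (t + 1)) _ _) _.
    - by rewrite ler_wpM2l.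
    - by rewrite ler_wpM2l // lerDl.
    by rewrite -mulrBr normrM (ger0_norm a0) mulrA mulrC.
  have : H s @[s --> t] --> expR (a * (t + 1)) * a * `|F t - F t|.
    apply: cvgM; first exact: cvg_cst.
    by apply: cvg_norm; apply: cvgB cF (cvg_cst _).
  by rewrite subrr normr0 mulr0.
have -> : (fun s => Icc_int 0 s (fun r => expR (a * r) * f r)
                    - expR (a * s) * Icc_int 0 s f) =
    (fun s => Icc_int 0 s g
       - (expR (a * s) - expR (a * t)) * (F s - F t)
       - (expR (a * s) - expR (a * t)) * F t).
  apply/funext => s.
  have -> : Icc_int 0 s g = Icc_int 0 s (fun r => expR (a * r) * f r)
      - expR (a * t) * F s.
    rewrite -mulNr -Icc_int_Zl // -Icc_int_D; last 2 first.
    - exact: L1locM.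
    - exact: L1locM.
    by apply: eq_Icc_int => r _; rewrite /g mulrBl mulNr.
  by rewrite -/(F s); ring.
eapply has_deriv_eq; first by derive.
by cbv beta; rewrite -/(F t); ring.
Unshelve. all: by end_near. Qed.

(** * Integrals of nonnegative functions over the half-line *)

Lemma le_Icc_int (R : realType) (f : R -> R) (s t : R) : L1loc f ->
  (forall r, 0 <= r -> 0 <= f r) -> s <= t -> Icc_int 0 s f <= Icc_int 0 t f.
Proof.
move=> lf f0 st.
rewrite /Icc_int /Rintegral; apply: fine_le.
- by apply: integrable_fin_num; [exact: measurable_itv | exact: L1loc_integrable].
- by apply: integrable_fin_num; [exact: measurable_itv | exact: L1loc_integrable].
- apply: ge0_subset_integral; try exact: measurable_itv.
  + exact: measurable_int (L1loc_integrable t lf).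
  + by move=> r /=; rewrite in_itv /= lee_fin => /andP[/f0].
  + by apply: subset_itvl; rewrite bnd_simp.
Qed.

Lemma Icc_int_le_integral (R : realType) (f : R -> R) (t : R) :
  {within `[0, +oo[, continuous f} -> (forall r, 0 <= r -> 0 <= f r) ->
  (\int[lebesgue_measure]_(s in `[0%R, +oo[) (f s)%:E < +oo)%E ->
  Icc_int 0 t f <= fine (\int[lebesgue_measure]_(s in `[0%R, +oo[) (f s)%:E)%E.
Proof.
move=> cf f0 foo; have lf := continuous_ge0_L1loc (continuous_ge0_itv cf).
rewrite /Icc_int /Rintegral; apply: fine_le.
- by apply: integrable_fin_num; [exact: measurable_itv | exact: L1loc_integrable].
- rewrite ge0_fin_numE //; apply: integral_ge0 => r /=.
  by rewrite in_itv /= andbT lee_fin => /f0.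
- apply: ge0_subset_integral; try exact: measurable_itv.
  + apply/measurable_realfun.measurable_EFinP.
    apply: measurable_realfun.subspace_continuous_measurable_fun cf.
    exact: measurable_itv.
  + by move=> r /=; rewrite in_itv /= andbT lee_fin => /f0.
  + by apply: subset_itvl; rewrite bnd_simp.
Qed.

(** Otherwise the nondecreasing primitive is bounded and has a finite limit, and the fundamental
    theorem on the half-line equates [+oo] with a real number. *)
Lemma diverges_Icc_int (R : realType) (f : R -> R) :
  {within `[0, +oo[, continuous f} -> (forall r, 0 <= r -> 0 <= f r) ->
  (\int[lebesgue_measure]_(s in `[0%R, +oo[) (f s)%:E = +oo)%E ->
  diverges (fun t => Icc_int 0 t f).
Proof.
move=> cf f0 foo M; apply: contrapT => bnd.
have c0f := continuous_ge0_itv cf; have lf := continuous_ge0_L1loc c0f.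
have leM t : Icc_int 0 t f <= M.
  rewrite leNgt; apply/negP => Mt; apply: bnd.
  exists (`|t| + 1); first by rewrite ltr_wpDl.
  move=> s ts; apply: (le_trans (ltW Mt)); apply: le_Icc_int => //.
  by rewrite (le_trans (ler_norm t)) // (le_trans _ ts) // lerDl.
have : Icc_int 0 t f @[t --> +oo] --> sup (range (fun t => Icc_int 0 t f)).
  apply: nondecreasing_cvgr; first by move=> s t; exact: le_Icc_int.
  by exists M => _ [t _ <-].
move=> lim.
suff : (+oo = (sup (range (fun t => Icc_int 0 t f)))%:E
              - (Icc_int 0 0 f)%:E)%E.
  by [].
rewrite -foo; apply: (@ge0_continuous_FTC2y _ f (fun t => Icc_int 0 t f)) => //.
- by move=> t t0; case: (has_deriv_int_continuous c0f t0).
- by have /(continuous_within_itvP _ ltr01)[] := continuous_ge0_int lf ltr01.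
- move=> t; rewrite in_itv /= andbT => t0.
  by rewrite derive1E; case: (has_deriv_int_continuous c0f t0).
Qed.

Lemma vanishes_ext (R : realType) (f g : R -> R) :
  (forall t, 0 < t -> f t = g t) -> vanishes f <-> vanishes g.
Proof.
move=> fg; split=> h e /h [T T0 hT]; exists T => // t Tt.
  by rewrite -fg ?hT // (lt_le_trans T0).
by rewrite fg ?hT // (lt_le_trans T0).
Qed.

(** * Integrals against the kernel [expR (- a * (t - s))] *)

Lemma Icc_int_filter (R : realType) (a t : R) (f : R -> R) : L1loc f ->
  Icc_int 0 t (fun s => expR (- a * (t - s)) * f s) =
  expR (- a * t) * Icc_int 0 t (fun s => expR (a * s) * f s).
Proof.
move=> lf; rewrite -Icc_int_Zl.
  apply: eq_Icc_int => s _; rewrite mulrA -expRD; congr (expR _ * _); ring.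
apply: L1locM lf; apply: continuous_ge0_total.
by apply: (@has_deriv_continuous _ _ (fun s => a * expR (a * s))) => s; derive_ring.
Qed.

Lemma continuous_expR_linear (R : realType) (a : R) :
  continuous_ge0 (fun s => expR (a * s)).
Proof.
apply: continuous_ge0_total.
by apply: (@has_deriv_continuous _ _ (fun s => a * expR (a * s))) => s; derive_ring.
Qed.

Lemma continuous_ge0_filter (R : realType) (a : R) (f : R -> R) : L1loc f ->
  continuous_ge0 (fun t => Icc_int 0 t (fun s => expR (- a * (t - s)) * f s)).
Proof.
(* Taking [expR (- a * t)] out of the integral leaves an integrand free of [t], so that only a
   primitive is involved. *)
move=> lf; rewrite (funext (fun t => Icc_int_filter a t lf)).
apply: (@continuous_ge0M _ (fun t => expR (- a * t))).
  exact: continuous_expR_linear.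
by apply: continuous_ge0_int; apply: L1locM lf; exact: continuous_expR_linear.
Qed.

Lemma has_deriv_filter (R : realType) (a t : R) (f : R -> R) :
  continuous_ge0 f -> 0 < t ->
  has_deriv (fun t => Icc_int 0 t (fun s => expR (- a * (t - s)) * f s)) t
    (f t - a * Icc_int 0 t (fun s => expR (- a * (t - s)) * f s)).
Proof.
move=> cf t0; have lf := continuous_ge0_L1loc cf.
rewrite (funext (fun t => Icc_int_filter a t lf)) Icc_int_filter //.
set g := fun s => expR (a * s) * f s.
have cg : continuous_ge0 g 
  by apply: continuous_ge0M cf; exact: continuous_expR_linear.
have dg := has_deriv_int_continuous cg t0.
eapply has_deriv_eq; first by derive.
have En0 := lt0r_neq0 (expR_gt0 (a * t)).
by cbv beta; rewrite {1}/g mulNr expRN; field.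
Qed.

(* [y1] solves [y1' = f - w^2 y1] only in the weak sense, but subtracting the
   primitive [int f] makes it differentiable. *)
Lemma has_deriv_filter_sub_int (R : realType) (a t : R) (f : R -> R) :
  L1loc f -> 0 <= a -> 0 < t ->
  has_deriv (fun t => Icc_int 0 t (fun s => expR (- a * (t - s)) * f s)
                      - Icc_int 0 t f) t
    (- a * Icc_int 0 t (fun s => expR (- a * (t - s)) * f s)).
Proof.
move=> lf a0 t0; have dN := has_deriv_int_parts lf a0 t0.
pose N s := Icc_int 0 s (fun r => expR (a * r) * f r)
            - expR (a * s) * Icc_int 0 s f.
have -> : (fun t => Icc_int 0 t (fun s => expR (- a * (t - s)) * f s)
    - Icc_int 0 t f) = (fun s => expR (- a * s) * N s).
  apply/funext => s; rewrite Icc_int_filter // /N mulrBr mulrA -expRD.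
  by rewrite mulNr addNr expR0 mul1r.
have {}dN : has_deriv N t (- (a * expR (a * t) * Icc_int 0 t f)) := dN.
eapply has_deriv_eq; first by derive.
have En0 := lt0r_neq0 (expR_gt0 (a * t)).
by cbv beta; rewrite Icc_int_filter // /N mulNr expRN; field.
Qed.

(** * The damped oscillating integral and its conjugate *)

Section RotatingIntegral.
Context (R : realType) (w al be : R) (p y : R -> R).
Context (cp : continuous_ge0 p) (cy : continuous_ge0 y).

Let K t := 2^-1 * Icc_int 0 t p.

Let ccos : continuous_ge0 (fun s => cos (w * s)).
Proof.
apply: continuous_ge0_total.
by apply: (@has_deriv_continuous _ _ (fun s => - sin (w * s) * w)) => s; derive_ring.
Qed.

Let csin : continuous_ge0 (fun s => sin (w * s)).
Proof.
apply: continuous_ge0_total.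
by apply: (@has_deriv_continuous _ _ (fun s => cos (w * s) * w)) => s; derive_ring.
Qed.

Let cexpK : continuous_ge0 (fun s => expR (K s)).
Proof.
apply: (@continuous_ge0_comp _ K expR); first exact: continuous_expR.
apply: continuous_ge0M; first by apply: continuous_ge0_total; exact: cst_continuous.
by apply: continuous_ge0_int; exact: continuous_ge0_L1loc.
Qed.

Let cC : continuous_ge0 (fun s => expR (K s) * cos (w * s) * y s).
Proof. exact: continuous_ge0M (continuous_ge0M cexpK ccos) cy. Qed.

Let cS : continuous_ge0 (fun s => expR (K s) * sin (w * s) * y s).
Proof. exact: continuous_ge0M (continuous_ge0M cexpK csin) cy. Qed.

Let C t := Icc_int 0 t (fun s => expR (K s) * cos (w * s) * y s).
Let S t := Icc_int 0 t (fun s => expR (K s) * sin (w * s) * y s).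

(** The kernel [al * sin + be * cos] in [w * (t - s)], expanded by the angle-difference formulas so
    that [t] stays outside the integrals [C] and [S]. *)
Definition rotating_integral t := expR (- K t) *
  ((al * sin (w * t) + be * cos (w * t)) * C t +
   (be * sin (w * t) - al * cos (w * t)) * S t).

(** The same for the kernel [al * cos - be * sin], which is [1 / w] times the [t]-derivative of the
    previous one. *)
Definition rotating_integral_conj t := expR (- K t) *
  ((al * cos (w * t) - be * sin (w * t)) * C t +
   (al * sin (w * t) + be * cos (w * t)) * S t).

Lemma rotating_integralE t : 0 <= t ->
  Icc_int 0 t (fun s => Efun p t s *
    (al * sin (w * (t - s)) + be * cos (w * (t - s))) * y s) =
  rotating_integral t.
Proof.
move=> t0; have lp := continuous_ge0_L1loc cp.
have lC := continuous_ge0_L1loc cC; have lS := continuous_ge0_L1loc cS.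
have lZ c f : L1loc f -> L1loc (fun s : R => c * f s).
  by apply: L1locM; apply: continuous_ge0_total; exact: cst_continuous.
rewrite /rotating_integral /C /S mulrDr !mulrA -!Icc_int_Zl // -Icc_int_D; [|exact: lZ..].
apply: eq_Icc_int => s /andP[s0 st].
have -> : Efun p t s = expR (- K t) * expR (K s).
  rewrite /Efun -expRD; congr expR.
  have -> : Icc_int s t p = Icc_int 0 t p - Icc_int 0 s p.
    rewrite Icc_int_cat //; apply/esym.
    apply: Rintegral_itv_obnd_cbnd.
    apply: integrableS (L1loc_integrable t lp) => //.
    by apply: subset_itvr; rewrite bnd_simp.
  by rewrite /K; ring.
by rewrite mulrBr sinB cosB; ring.
Qed.

Let dK t : 0 < t -> has_deriv K t (2^-1 * p t).
Proof.
by move=> t0; have dp := has_deriv_int_continuous cp t0; rewrite /K; derive_ring.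
Qed.

Let dC t : 0 < t -> has_deriv C t (expR (K t) * cos (w * t) * y t).
Proof. exact: has_deriv_int_continuous cC. Qed.

Let dS t : 0 < t -> has_deriv S t (expR (K t) * sin (w * t) * y t).
Proof. exact: has_deriv_int_continuous cS. Qed.

Lemma has_deriv_rotating_integral t : 0 < t ->
  has_deriv rotating_integral t
   (- (2^-1 * p t) * rotating_integral t + w * rotating_integral_conj t + be * y t).
Proof.
move=> t0; rewrite {1}/rotating_integral; eapply has_deriv_eq; first by derive.
have En0 := lt0r_neq0 (expR_gt0 (K t)).
(* The terms in [y] are gathered around [cos ^+ 2 + sin ^+ 2], because [field] does not know the
   Pythagorean identity. *)
transitivity (- (2^-1 * p t) * rotating_integral t + w * rotating_integral_conj t
    + be * y t * (cos (w * t) ^+ 2 + sin (w * t) ^+ 2)).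
  by rewrite /rotating_integral /rotating_integral_conj expRN; field.
by rewrite cos2Dsin2 mulr1.
Qed.

Lemma has_deriv_rotating_integral_conj t : 0 < t ->
  has_deriv rotating_integral_conj t
   (- (2^-1 * p t) * rotating_integral_conj t - w * rotating_integral t + al * y t).
Proof.
move=> t0; rewrite {1}/rotating_integral_conj; eapply has_deriv_eq; first by derive.
have En0 := lt0r_neq0 (expR_gt0 (K t)).
transitivity (- (2^-1 * p t) * rotating_integral_conj t - w * rotating_integral t
    + al * y t * (cos (w * t) ^+ 2 + sin (w * t) ^+ 2)).
  by rewrite /rotating_integral /rotating_integral_conj expRN; field.
by rewrite cos2Dsin2 mulr1.
Qed.

End RotatingIntegral.

(** * Reduction of the differential equation to the damped system *)

Lemma damped_system_of_solution (R : realType) (w : R) (p p' f x v : R -> R) :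
  0 < w -> damping_ok p p' -> L1loc f -> is_solution p w f x v ->
  exists q0 B q dq K S z1 J,
    damped_system w q0 B q dq K S (y1 w f) (y2 w f)
      (fun t => x t - y2 w f t) z1
      (rotating_integral w (w ^+ 3 - w) (2 * w ^+ 2) p (y2 w f)) J.
Proof.
move=> w0 [cp [dp [_ [p0 [p'0 [poo p2oo]]]]]] lf [cx [dx [cv sol]]].
have cp0 := continuous_ge0_itv cp.
have cx0 := continuous_ge0_itv cx.
have cv0 := continuous_ge0_itv cv.
pose a := w ^+ 2; have a0 : 0 <= a by exact: sqr_ge0.
have ccst (c : R) : continuous_ge0 (fun=> c).
  by apply: continuous_ge0_total; exact: cst_continuous.
have ple t : 0 < t -> p t <= p 0.
  move=> t0; apply: (@ler0_derive1_nincry _ p 0 _ _ cp) => //; last exact: ltW.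
  - by move=> s; rewrite in_itv /= andbT => /dp[].
  - move=> s; rewrite in_itv /= andbT => s0.
    by rewrite derive1E (@derive_val _ _ _ _ _ _ _ (dp _ s0)) ltW // p'0 ?ltW.
have cp2 : {within `[0, +oo[, continuous (fun s => p s ^+ 2)}.
  have -> : (fun s => p s ^+ 2) = (fun s => p s * p s) by [].
  by move=> s; apply: cvgM; exact: cp.
have p2_ge0 s : 0 <= s -> 0 <= p s ^+ 2 by move=> _; exact: sqr_ge0.
pose u := y1 w f; pose y := y2 w f.
have cu : continuous_ge0 u by exact: continuous_ge0_filter.
have cy : continuous_ge0 y.
  by apply: continuous_ge0_filter; exact: continuous_ge0_L1loc.
have dy t : 0 < t -> has_deriv y t (u t - a * y t) by exact: has_deriv_filter.
have cg : continuous_ge0 (fun s => p s * v s + a * x s).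
  by apply: continuous_ge0D; apply: continuous_ge0M.
pose Q t := Icc_int 0 t (fun s => p s * v s + a * x s).
pose D t := u t - Icc_int 0 t f.
have dQ t : 0 < t -> has_deriv Q t (p t * v t + a * x t).
  exact: has_deriv_int_continuous.
have dD t : 0 < t -> has_deriv D t (- a * u t).
  exact: has_deriv_filter_sub_int.
have vE t : 0 <= t -> v t = v 0 + Icc_int 0 t f - Q t.
  move=> t0; rewrite [LHS]sol // -addrA; congr (_ + _).
  have lg := continuous_ge0_L1loc cg.
  rewrite -[- Q t]mulN1r -Icc_int_Zl // -Icc_int_D //; last exact: L1locM.
  by apply: eq_Icc_int => s _; rewrite mulN1r opprD addrA.
(* This is [v - u + a * y]. Both [v] and [u] contain the integral of [f], which need not be
   differentiable at every point; it cancels in the difference, and what remains has a classical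
   derivative. *)
pose z1 t := v 0 - Q t - D t + a * y t.
have z1E t : 0 < t -> z1 t = v t - u t + a * y t.
  by move=> /ltW/vE ->; rewrite /z1 /D; ring.
(* As [p] decreases, [q = p / 2] is at most [p 0 / 2]; the factor [1 / 4] in [B] and [S] comes from
   [q ^+ 2 = p ^+ 2 / 4]. *)
exists (2^-1 * p 0).
exists (4^-1 * fine (\int[lebesgue_measure]_(t in `[0%R, +oo[) ((p t) ^+ 2)%:E)%E).
exists (fun t => 2^-1 * p t), (fun t => 2^-1 * p' t), (fun t => 2^-1 * Icc_int 0 t p).
exists (fun t => 4^-1 * Icc_int 0 t (fun s => p s ^+ 2)), z1.
exists (rotating_integral_conj w (w ^+ 3 - w) (2 * w ^+ 2) p y).
split.
- exact: w0.
- have pge s : 0 <= s -> 0 <= p s by move/p0/ltW.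
  move=> M; have [T T0 hT] := diverges_Icc_int cp pge poo (2 * M).
  by exists T => // t /hT; lra.
- by move=> t t0; have := ple _ t0; have := p0 _ (ltW t0); lra.
- by move=> t t0; have := p'0 _ (ltW t0); lra.
- by move=> t t0; rewrite ler_pM2l ?invr_gt0 //; exact: Icc_int_le_integral.
- by move=> t t0; have dpt : has_deriv p t (p' t) := dp _ t0; derive_ring.
- by move=> t t0; have := has_deriv_int_continuous cp0 t0 => ?; derive_ring.
- move=> t t0.
  have := has_deriv_int_continuous (continuous_ge0_itv cp2) t0 => ?.
  by eapply has_deriv_eq; [derive | cbv beta; field].
- exact: dy.
- move=> t t0; have dxt : has_deriv x t (v t) := dx _ t0.
  have dyt := dy _ t0.
  by eapply has_deriv_eq; [derive | rewrite z1E // -/y; ring].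
- move=> t t0; have := dy _ t0; have := dQ _ t0; have := dD _ t0 => *.
  rewrite z1E // -/y -/u /z1.
  by eapply has_deriv_eq; [derive | cbv beta; rewrite /a; field].
- by move=> t t0; apply: has_deriv_rotating_integral.
- by move=> t t0; apply: has_deriv_rotating_integral_conj.
Qed.

Theorem mainTheorem15 (R : realType) (w : R) (p p' f x v : R -> R) :
  0 < w -> damping_ok p p' -> L1loc f -> is_solution p w f x v ->
  x 0 = 0 -> v 0 = 0 ->
  (x t @[t --> +oo] --> 0 <->
   (y2 w f t @[t --> +oo] --> 0 /\
    Icc_int 0 t (fun s => Efun p t s * L3 w t s * y2 w f s) @[t --> +oo] --> 0)).
Proof.
move=> w0 pok lf sol _ _.
have [q0 [B [q [dq [K [S [z1 [J ds]]]]]]]] := damped_system_of_solution w0 pok lf sol.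
have cp := continuous_ge0_itv pok.1.
have cy : continuous_ge0 (y2 w f).
  apply: continuous_ge0_filter; apply: continuous_ge0_L1loc.
  exact: continuous_ge0_filter.
have xE : vanishes x <-> vanishes (fun t => x t - y2 w f t + y2 w f t).
  by apply: vanishes_ext => t _; rewrite subrK.
(* The kernel [L3] has coefficients [al = w ^+ 3 - w] and [be = 2 * w ^+ 2]; the two integrals agree
   for [t > 0], which is enough at infinity. *)
have IE := vanishes_ext (fun t t0 => rotating_integralE w (w ^+ 3 - w)
  (2 * w ^+ 2) cp cy (ltW t0)).
apply: iff_trans (vanishesP x) _; apply: iff_trans xE _.
apply: iff_trans (damped_system_vanishes ds) _.
split=> -[y0 I0]; split.
- exact/vanishesP.
- by apply/vanishesP; apply/IE.
- exact/vanishesP.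
- by apply/IE; apply/vanishesP.
Qed.
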